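(* Let $\mathbb{K}$ be a countably infinite field and let $(F_n)$ be a double Følner sequence in $\mathbb{K}$. Then, for all $(\xi_1,\xi_2) \in \widehat{\mathbb{K}}\times\widehat{\mathbb{K}}$ with $\xi_1 \neq 1$, we have $$\lim_{n\to\infty} \frac{1}{|F_n|}\sum_{a \in F_n\setminus\{0\}} \xi_1(a)\,\xi_2(a^{-1}) = 0.$$
   Context: $\widehat{\mathbb{K}} = \operatorname{Hom}((\mathbb{K},+),\mathbb{S}^1)$ is the group of all characters of the discrete additive group of $\mathbb{K}$, with trivial character denoted $1$. A double Følner sequence in $\mathbb{K}$ is a sequence $(F_n)$ of non-empty finite subsets of $\mathbb{K}$ that is asymptotically invariant under both addition and multiplication: $|F_n \cap (F_n + b)|/|F_n| \to 1$ for every $b \in \mathbb{K}$ and $|F_n\cap aF_n|/|F_n| \to 1$ for every $a \in \mathbb{K}^*$. *)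

(* Defs.v *)
From HB Require Import structures.
From mathcomp Require Import all_boot all_order all_algebra finmap.
From mathcomp Require Import all_classical all_reals all_analysis.
From mathcomp Require Import complex.

Set Implicit Arguments.
Unset Strict Implicit.
Unset Printing Implicit Defensive.

Import Order.TTheory GRing.Theory Num.Theory.
Import numFieldNormedType.Exports.

Local Open Scope classical_set_scope.
Local Open Scope fset_scope.
Local Open Scope ring_scope.
Local Open Scope complex_scope.

(* Hom((K,+), S^1), as a set of functions; the norm is that of R[i] and so is
   R[i]-valued. The additive group of K is discrete: no continuity is asked. *)
Definition dual (R : realType) (K : fieldType) : set (K -> R[i]) :=
  [set xi | (forall a, `|xi a| = 1) /\
            (forall a b, xi (a + b) = xi a * xi b)].

Arguments dual : clear implicits.

Definition double_folner (R : realType) (K : fieldType) (F : nat -> {fset K}) :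
    Prop :=
  [/\ forall n, F n != fset0,
      forall b : K,
        #|` F n `&` [fset x + b | x in F n]|%:R / #|` F n|%:R
          @[n --> \oo] --> (1 : R) &
      forall a : K, a != 0 ->
        #|` F n `&` [fset a * x | x in F n]|%:R / #|` F n|%:R
          @[n --> \oo] --> (1 : R)].

(* Main.v *)
Require Import Defs.
From HB Require Import structures.
From mathcomp Require Import all_boot all_order all_algebra finmap.
From mathcomp Require Import all_classical all_reals all_analysis.
From mathcomp Require Import complex.
From mathcomp Require Import ring lra.

Set Implicit Arguments.
Unset Strict Implicit.
Unset Printing Implicit Defensive.

Import Order.TTheory GRing.Theory Num.Theory.
Import numFieldNormedType.Exports.

Local Open Scope classical_set_scope.
Local Open Scope fset_scope.
Local Open Scope ring_scope.
Local Open Scope complex_scope.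

(** Write [m h] for the limit, along [n], of the averages of a bounded [h] over
    [F n], as if it existed: it is a positive functional invariant under
    [a |-> a + b] and [a |-> c * a].  Let [k_s a = xi1 (s * a) * xi2 a^-1] and
    [phi s = m k_s]; the claim is [phi 1 = 0].

    For [s != t] the product of [k_s] and the conjugate of [k_t] is the
    nontrivial character [a |-> xi1 ((s - t) * a)], the factors [xi2 a^-1]
    cancelling, and invariance under addition forces [m] to vanish on it.  So
    the [k_s] are orthonormal, and Bessel's inequality shows that [phi] is
    square-summable on [K] ([bessel_kloosterman]).

    Invariance under multiplication then propagates this to a bound on [phi 1].
    All the dilates [a |-> k_1 (c * a)] have mean [phi 1], and up to a further
    dilation the product of the [c]-th with the conjugate of the [d]-th is [k_q]
    for [q = (c - d) * (c^-1 - d^-1)].  By the Cauchy-Schwarz inequality, over a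
    set [C] of [N] nonzero elements, [`|phi 1| ^+ 2] is at most [1 / N] plus the
    average of [`|phi q|] over the pairs of distinct elements of [C].  For fixed
    [c] the map [d |-> q] is at most two-to-one, so by square-summability this
    average is [O(1 / sqrt N)]; and [N] is arbitrary because [K] is infinite
    ([avg_kloosterman]).

    The limits need not exist, so these inequalities are proved at each [n],
    with errors that tend to [0] for each fixed finite set of parameters.  The
    averages include the point [0], where [0^-1 = 0], so that all the functions
    involved are total; the weight of [0] in [F n] tends to [0]
    ([avg_indicator0]). *)

(** * The absolute value of a complex number, as a real number *)

Section Modulus.
Variable R : realType.
Implicit Types z w : R[i].

(** The norm of [R[i]] takes its values in [R[i]], whose order is partial;
    with values in [R] the estimates below are between totally ordered reals. *)
Definition modulus z : R := complex.Re `|z|.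

Lemma modulusE z : (modulus z)%:C = `|z|.
Proof. by []. Qed.

Lemma modulus_ge0 z : 0 <= modulus z.
Proof. by rewrite -lecR modulusE normr_ge0. Qed.

Lemma modulus1 : modulus 1 = 1.
Proof. by apply: complexI; rewrite modulusE normr1. Qed.

Lemma modulusM z w : modulus (z * w) = modulus z * modulus w.
Proof. by apply: complexI; rewrite rmorphM /= !modulusE normrM. Qed.

Lemma modulusN z : modulus (- z) = modulus z.
Proof. by apply: complexI; rewrite !modulusE normrN. Qed.

Lemma modulusJ z : modulus z^* = modulus z.
Proof. by apply: complexI; rewrite !modulusE normcJ. Qed.

Lemma modulus_nat n : modulus n%:R = n%:R.
Proof. by apply: complexI; rewrite modulusE normr_nat rmorph_nat. Qed.

Lemma modulus_eq0 z : (modulus z == 0) = (z == 0).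
Proof. by rewrite -(inj_eq (@complexI R)) modulusE normr_eq0. Qed.

Lemma modulusV z : modulus z^-1 = (modulus z)^-1.
Proof. by apply: complexI; rewrite fmorphV /= !modulusE normfV. Qed.

Lemma ler_modulusD z w : modulus (z + w) <= modulus z + modulus w.
Proof. by rewrite -lecR rmorphD /= !modulusE ler_normD. Qed.

Lemma ler_modulusB z w : modulus (z - w) <= modulus z + modulus w.
Proof. by rewrite -(modulusN w) ler_modulusD. Qed.

Lemma ler_modulus_sum I (r : seq I) (P : pred I) (f : I -> R[i]) :
  modulus (\sum_(i <- r | P i) f i) <= \sum_(i <- r | P i) modulus (f i).
Proof.
have -> : \sum_(i <- r | P i) modulus (f i) =
    complex.Re (\sum_(i <- r | P i) `|f i|) by rewrite raddf_sum.
rewrite -lecR modulusE RRe_real ?sum_real//; exact: ler_norm_sum.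
Qed.

Lemma ler_modulus z w : 0 <= z -> z <= w -> modulus z <= modulus w.
Proof.
by move=> z0 zw; rewrite -lecR !modulusE !ger0_norm// (le_trans z0).
Qed.

Lemma sqr_modulus z : (modulus z ^+ 2)%:C = z * z^*.
Proof. by rewrite rmorphXn /= modulusE sqr_normc. Qed.

End Modulus.

(** * Averages over a finite set *)

Section Average.
Variables (R : realType) (T : choiceType).
Implicit Types (A : {fset T}) (h : T -> R[i]).

Definition avg A h : R[i] := #|` A|%:R^-1 * \sum_(a <- A) h a.

Lemma avg_sum A I (r : seq I) (c : I -> R[i]) (h : I -> T -> R[i]) :
  avg A (fun a => \sum_(i <- r) c i * h i a) = \sum_(i <- r) c i * avg A (h i).
Proof.
rewrite /avg exchange_big /= mulr_sumr; apply: eq_bigr => i _.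
by rewrite -mulr_sumr mulrCA.
Qed.

Lemma modulus_avg_le1 A h : (forall a, modulus (h a) <= 1) -> 
  modulus (avg A h) <= 1.
Proof.
move=> h1; rewrite /avg modulusM modulusV modulus_nat.
have [->|A0] := eqVneq A fset0; first by rewrite cardfs0 invr0 mul0r ler01.
rewrite mulrC ler_pdivrMr ?ltr0n ?cardfs_gt0// mul1r.
apply: (le_trans (ler_modulus_sum _ _ _)).
rewrite (card_fset_sum1 A) natr_sum; exact: ler_sum.
Qed.

(** The variance of [h] over [A] is nonnegative. *)
Lemma sqr_modulus_avg A h : A != fset0 ->
  modulus (avg A h) ^+ 2 <= modulus (avg A (fun a => h a * (h a)^*)).
Proof.
move=> A0; set m := avg A h.
have N0 : (#|` A|%:R : R[i]) != 0 by rewrite pnatr_eq0 -lt0n cardfs_gt0.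
have sumE : \sum_(a <- A) h a = #|` A|%:R * m.
  by rewrite /m /avg mulrA divff// mul1r.
have sumJE : \sum_(a <- A) (h a)^* = #|` A|%:R * m^*.
  by rewrite -(rmorph_sum (@conjc R)) sumE rmorphM rmorph_nat.
have varE : avg A (fun a => h a * (h a)^*) - m * m^*
    = avg A (fun a => (h a - m) * (h a - m)^*).
  rewrite /avg.
  under [in RHS]eq_bigr => a _.
    rewrite rmorphB /= mulrBl !mulrBr opprB addrA.
    rewrite (_ : _ - _ + _ - _ =
      h a * (h a)^* - m^* * h a - (m * (h a)^* - m * m^*)); last by ring.
    over.
  rewrite !sumrB -!mulr_sumr sumE sumJE big_const_seq count_predT iter_addr_0.
  by rewrite -[_ *+ size _]mulr_natl; field.
have -> : modulus m ^+ 2 = modulus (m * m^*) by rewrite modulusM modulusJ.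
apply: ler_modulus; first by rewrite -sqr_normc exprn_ge0.
rewrite -subr_ge0 varE mulr_ge0 ?invr_ge0 ?ler0n// sumr_ge0// => a _.
by rewrite -sqr_normc exprn_ge0.
Qed.

(** The Cauchy-Schwarz inequality, in the form that serves twice.  With [c i]
    the conjugate of [avg A (g i)] it gives Bessel's inequality for an almost
    orthonormal family; with [c i = 1] and the [g i] of equal averages it bounds
    that common average by the correlations of the [g i]. *)
Lemma gram_bound A I (r : seq I) (c : I -> R[i]) (g : I -> T -> R[i]) :
  A != fset0 ->
  modulus (\sum_(i <- r) c i * avg A (g i)) ^+ 2 <=
  \sum_(i <- r) \sum_(j <- r)
    modulus (c i) * modulus (c j) *
      modulus (avg A (fun a => g i a * (g j a)^*)).
Proof.
move=> A0; rewrite -avg_sum; apply: (le_trans (sqr_modulus_avg _ A0)).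
rewrite [X in modulus X](_ : _ = \sum_(i <- r) \sum_(j <- r)
    c i * (c j)^* * avg A (fun a => g i a * (g j a)^*)); last first.
  under [RHS]eq_bigr do rewrite -avg_sum.
  rewrite -[RHS](eq_bigr _ (fun i _ => mul1r _)) -avg_sum.
  congr avg; apply/funext => a; rewrite rmorph_sum /= mulr_suml.
  apply: eq_bigr => i _; rewrite mul1r mulr_sumr; apply: eq_bigr => j _.
  by rewrite rmorphM /=; ring.
apply: (le_trans (ler_modulus_sum _ _ _)); apply: ler_sum => i _.
apply: (le_trans (ler_modulus_sum _ _ _)); apply: ler_sum => j _.
by rewrite !modulusM modulusJ.
Qed.

(** Moving [A] by an injection replaces the points of [A `\` s A] by those of
    [s A `\` A], and these two sets have the same cardinality. *)
Lemma modulus_avg_comp A h (s : T -> T) : A != fset0 -> injective s ->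
    (forall a, modulus (h a) <= 1) ->
  modulus (avg A (h \o s) - avg A h) <=
  2 * (1 - #|` A `&` [fset s x | x in A]|%:R / #|` A|%:R).
Proof.
move=> A0 s_inj h1; set B := [fset s x | x in A].
have cardB : #|` B| = #|` A| by rewrite card_imfset.
have sumB : \sum_(a <- A) (h \o s) a = \sum_(b <- B) h b.
  by rewrite big_imfset//; apply: in2W.
have N0 : (#|` A|%:R : R) != 0 by rewrite pnatr_eq0 -lt0n cardfs_gt0.
have split (X Y : {fset T}) :
    \sum_(x <- X) h x = \sum_(x <- X `&` Y) h x + \sum_(x <- X `\` Y) h x.
  rewrite (big_fsetID _ (mem Y)); congr (_ + _); apply: eq_fbigl => x.
    by rewrite !inE.
  by rewrite !inE andbC.
have bound (X : {fset T}) : modulus (\sum_(x <- X) h x) <= #|` X|%:R.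
  apply: (le_trans (ler_modulus_sum _ _ _)).
  by rewrite (card_fset_sum1 X) natr_sum; apply: ler_sum.
have cardD (X Y : {fset T}) :
    #|` X `\` Y|%:R = #|` X|%:R - #|` X `&` Y|%:R :> R.
  by apply/eqP; rewrite eq_sym subr_eq -natrD addnC cardfsID.
rewrite /avg -mulrBr sumB (split A B) (split B A) fsetIC.
rewrite opprD addrACA subrr add0r.
rewrite modulusM modulusV modulus_nat ler_pdivrMl ?ltr0n ?cardfs_gt0//.
apply: (le_trans (ler_modulusB _ _)).
apply: (le_trans (lerD (bound _) (bound _))).
rewrite !cardD cardB [B `&` A]fsetIC le_eqVlt; apply/orP; left; apply/eqP.
by field.
Qed.

End Average.

Lemma sum_eq_op (R : pzSemiRingType) (T : choiceType) (A : {fset T}) (x : T) :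
  \sum_(a <- A) (a == x)%:R = (x \in A)%:R :> R.
Proof.
rewrite -natr_sum; congr _%:R.
rewrite -count_uniq_mem ?fset_uniq// -sum1_count [RHS]big_mkcond.
by apply: eq_bigr => a _ /=; case: eqP.
Qed.

(** * Averages along a double Folner sequence *)

Section Folner.
Variables (R : realType) (K : fieldType) (F : nat -> {fset K}).
Hypothesis F_folner : double_folner R F.

Lemma folner_neq0 n : F n != fset0.
Proof. by case: F_folner. Qed.

Lemma folner_invariance (s : K -> K) (h : K -> R[i]) : injective s ->
    (forall a, modulus (h a) <= 1) ->
    #|` F n `&` [fset s x | x in F n]|%:R / #|` F n|%:R
      @[n --> \oo] --> (1 : R) ->
  modulus (avg (F n) (h \o s) - avg (F n) h) @[n --> \oo] --> (0 : R).
Proof.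
move=> s_inj h1 sF.
apply: (@squeeze_cvgr _ _ _ _ (cst 0) (fun n =>
    2 * (1 - #|` F n `&` [fset s x | x in F n]|%:R / #|` F n|%:R))).
- near=> n; rewrite modulus_ge0/=.
  by rewrite modulus_avg_comp// folner_neq0.
- exact: cvg_cst.
- rewrite [X in _ --> X](_ : 0 = 2 * (1 - 1)); last by rewrite subrr mulr0.
  by apply: cvgMr; apply: cvgB => //; apply: cvg_cst.
Unshelve. all: by end_near. Qed.

Lemma avg_translate (b : K) (h : K -> R[i]) : (forall a, modulus (h a) <= 1) ->
  modulus (avg (F n) (fun a => h (a + b)) - avg (F n) h)
    @[n --> \oo] --> (0 : R).
Proof.
move=> h1; case: F_folner => _ Fadd _.
exact: (folner_invariance (@addIr _ b) h1 (Fadd b)).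
Qed.

Lemma avg_scale (c : K) (h : K -> R[i]) : c != 0 ->
    (forall a, modulus (h a) <= 1) ->
  modulus (avg (F n) (fun a => h (c * a)) - avg (F n) h)
    @[n --> \oo] --> (0 : R).
Proof.
move=> c0 h1; case: F_folner => _ _ Fmul.
exact: (folner_invariance (mulfI c0) h1 (Fmul c c0)).
Qed.

End Folner.

(** * Characters *)

Section Characters.
Variables (R : realType) (K : fieldType) (xi : K -> R[i]).
Hypothesis xi_dual : dual R K xi.

Lemma modulus_dual a : modulus (xi a) = 1.
Proof. by apply: complexI; rewrite modulusE (proj1 xi_dual). Qed.

Lemma modulus_dual_le1 a : modulus (xi a) <= 1.
Proof. by rewrite modulus_dual. Qed.

Lemma dualD a b : xi (a + b) = xi a * xi b.
Proof. exact: (proj2 xi_dual). Qed.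

Lemma dual_neq0 a : xi a != 0.
Proof. by rewrite -modulus_eq0 modulus_dual oner_eq0. Qed.

Lemma dual_mulJ a : xi a * (xi a)^* = 1.
Proof. by rewrite -sqr_modulus modulus_dual expr1n. Qed.

Lemma dualB a b : xi (a - b) = xi a * (xi b)^*.
Proof.
apply: (mulIf (dual_neq0 b)).
by rewrite -dualD subrK -mulrA [_^* * _]mulrC dual_mulJ mulr1.
Qed.

Lemma dual_nontrivial : xi <> cst 1 -> exists x, xi x != 1.
Proof.
move=> xi1; apply: contrapT => /forallNP H; apply: xi1; apply/funext => x.
by have /negP := H x; rewrite negbK => /eqP.
Qed.

End Characters.

Lemma cvg_sum0 (R : realType) (I : eqType) (r : seq I) (P : pred I)
    (u : I -> nat -> R) :
    (forall i, i \in r -> P i -> u i n @[n --> \oo] --> (0 : R)) ->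
  \sum_(i <- r | P i) u i n @[n --> \oo] --> (0 : R).
Proof.
elim: r => [|i r IHr] u0.
  by under eq_cvg do rewrite big_nil; exact: cvg_cst.
have {}IHr : \sum_(j <- r | P j) u j n @[n --> \oo] --> (0 : R).
  by apply: IHr => j jr; apply: u0; rewrite inE jr orbT.
have [Pi|nPi] := boolP (P i); last first.
  by under eq_cvg do rewrite big_cons (negbTE nPi).
under eq_cvg do rewrite big_cons Pi.
by have := cvgD (u0 i (mem_head _ _) Pi) IHr; rewrite addr0; apply.
Qed.

(** * Kloosterman averages *)

Section Kloosterman.
Variables (R : realType) (K : fieldType) (F : nat -> {fset K}).
Hypothesis F_folner : double_folner R F.

(** Translating by [x / u] multiplies the average by [xi x], and leaves it
    almost unchanged; take [x] with [xi x != 1]. *)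
Lemma avg_character (xi : K -> R[i]) (u : K) : dual R K xi -> xi <> cst 1 ->
    u != 0 ->
  modulus (avg (F n) (fun a => xi (u * a))) @[n --> \oo] --> (0 : R).
Proof.
move=> xi_dual /dual_nontrivial[x xx u0].
pose d := modulus (xi x - 1).
have d0 : d != 0 by rewrite modulus_eq0 subr_eq0.
have H := @avg_translate R K F F_folner (x / u) (fun a => xi (u * a)).
have {H} : modulus (avg (F n) (fun a => xi (u * a))) * d
    @[n --> \oo] --> (0 : R).
  have {}H := H (fun a => modulus_dual_le1 xi_dual _).
  apply: cvg_trans H; apply: near_eq_cvg; near=> n.
  rewrite -modulusM; congr modulus.
  under [in LHS]eq_fun do rewrite mulrDr mulrCA divff// mulr1 dualD//.
  rewrite /avg -mulr_suml; ring.
set v := (X in X n @[n --> _] --> _) => H.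
have {H} : v n * d * d^-1 @[n --> \oo] --> (0 * d^-1 : R).
  by apply: cvgM H _; apply: cvg_cst.
by rewrite mul0r; under eq_cvg do rewrite /v mulfK//.
Unshelve. all: by end_near. Qed.

(** The translates of the indicator of [0] by the elements of a set [B] sum to
    at most [1], and all have nearly the same average, which is therefore at
    most about [1 / #|` B|]. *)
Lemma avg_indicator0 : infinite_set [set: K] ->
  modulus (avg (F n) (fun a => (a == 0)%:R)) @[n --> \oo] --> (0 : R).
Proof.
move=> K_infinite; apply/cvgrPdist_le => e e0.
have [N Ne] : exists N : nat, 2 / e <= N%:R.
  by exists (Num.bound (2 / e)); apply/ltW/archi_boundP; rewrite divr_ge0// ltW.
have [B _ NB] := infinite_set_fset N K_infinite.
pose h (a : K) : R[i] := (a == 0)%:R.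
have h1 a : modulus (h a) <= 1 by rewrite modulus_nat lern1 leq_b1.
pose u b n := modulus (avg (F n) (fun a => h (a + b)) - avg (F n) h).
have : \sum_(b <- B) u (- b) n @[n --> \oo] --> (0 : R).
  by apply: cvg_sum0 => b _ _; apply: avg_translate.
move=> /cvgr0_norm_le /(_ 1 ltr01).
apply: filterS => n /(le_trans (ler_norm _)) un.
rewrite sub0r normrN ger0_norm ?modulus_ge0//.
have B0 : 0 < #|` B|%:R :> R.
  apply: lt_le_trans (_ : N%:R <= _); last by rewrite ler_nat.
  by apply: lt_le_trans Ne; rewrite divr_gt0.
suff : #|` B|%:R * modulus (avg (F n) h) <= 2.
  move=> H; rewrite -(ler_pM2l B0); apply: (le_trans H).
  by rewrite -ler_pdivrMr//; apply: (le_trans Ne); rewrite ler_nat.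
rewrite -(modulus_nat R) -modulusM.
have -> : #|` B|%:R * avg (F n) h =
    avg (F n) (fun a => \sum_(b <- B) 1 * h (a - b))
    - \sum_(b <- B) (avg (F n) (fun a => h (a - b)) - avg (F n) h).
  rewrite avg_sum; under eq_bigr do rewrite mul1r.
  rewrite sumrB opprB addrC subrK big_const_seq count_predT iter_addr_0.
  by rewrite mulr_natl.
apply: (le_trans (ler_modulusB _ _)); rewrite (_ : 2 = 1 + 1)//; apply: lerD.
  apply: modulus_avg_le1 => a.
  under eq_bigr do rewrite mul1r /h subr_eq0 eq_sym.
  by rewrite sum_eq_op modulus_nat lern1 leq_b1.
by apply: le_trans un; apply: ler_modulus_sum.
Qed.

Lemma avg_setD1_0 (h : K -> R[i]) A :
  #|` A|%:R^-1 * \sum_(a <- A `\ 0) h a =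
  avg A h - h 0 * avg A (fun a => (a == 0)%:R).
Proof.
rewrite /avg mulrCA -mulrBr sum_eq_op; congr (_ * _).
have [A0|A0] := boolP (0 \in A); last by rewrite mem_fsetD1// mulr0 subr0.
by rewrite mulr1 (big_fsetD1 0 A0) /= addrAC subrr add0r.
Qed.

Variables xi1 xi2 : K -> R[i].
Hypotheses (xi1_dual : dual R K xi1) (xi2_dual : dual R K xi2).
Hypothesis xi1_neq1 : xi1 <> cst 1.

(** The summand of the Kloosterman sum of [xi1] and [xi2] with [xi1] dilated by
    [s].  Dilating [xi2] by a nonzero element gives no new averages along [F],
    by invariance under multiplication, so one parameter is enough. *)
Definition kloosterman s (a : K) : R[i] := xi1 (s * a) * xi2 a^-1.
Local Notation kl := kloosterman.

Lemma modulus_kloosterman s a : modulus (kl s a) = 1.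
Proof. by rewrite modulusM !modulus_dual// mulr1. Qed.

Lemma kloosterman_le1 s a : modulus (kl s a) <= 1.
Proof. by rewrite modulus_kloosterman. Qed.

Lemma kloosterman_mulJ s t a : kl s a * (kl t a)^* = xi1 ((s - t) * a).
Proof.
rewrite /kl rmorphM /= mulrACA dual_mulJ// mulr1 -dualB//.
by rewrite mulrBl.
Qed.

(** The parameter [s] for which [kl s] is, up to a dilation, the product of
    [kl 1 (c * a)] and the conjugate of [kl 1 (d * a)]. *)
Definition corr_freq c d : K := (c - d) * (c^-1 - d^-1).

Lemma kloosterman_dilateJ c d a : c != 0 -> d != 0 -> c != d ->
  kl 1 (c * a) * (kl 1 (d * a))^* =
  kl (corr_freq c d) ((c^-1 - d^-1)^-1 * a).
Proof.
move=> c0 d0 cd.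
have v0 : c^-1 - d^-1 != 0 by rewrite subr_eq0 (inj_eq invr_inj).
rewrite /kl /corr_freq rmorphM /= mulrACA -!dualB//; congr (xi1 _ * xi2 _).
  by rewrite !mul1r mulrA mulfK// mulrBl.
by rewrite !invfM invrK mulrBl.
Qed.

(** Bessel's inequality for the constant function [1] and the family
    [kl s], which is asymptotically orthonormal by [kloosterman_mulJ] and
    [avg_character].  An exactly orthonormal family would give [1]; the
    constant [2] absorbs the error. *)
Lemma bessel_kloosterman (S : {fset K}) :
  \forall n \near \oo, \sum_(s <- S) modulus (avg (F n) (kl s)) ^+ 2 <= 2.
Proof.
pose G s t n := modulus (avg (F n) (fun a => xi1 ((s - t) * a))).
have : \sum_(s <- S) \sum_(t <- S | t != s) G s t n @[n --> \oo] --> (0 : R).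
  apply: cvg_sum0 => s _ _; apply: cvg_sum0 => t _ ts.
  by apply: avg_character => //; rewrite subr_eq0 eq_sym.
move=> /cvgr0_norm_le /(_ 2 ltac:(lra)).
apply: filterS => n /(le_trans (ler_norm _)) Gn.
pose y s := modulus (avg (F n) (kl s)).
have y0 s : 0 <= y s by exact: modulus_ge0.
have y1 s : y s <= 1 by apply: modulus_avg_le1 => a; exact: kloosterman_le1.
rewrite -/(\sum_(s <- S) y s ^+ 2); set Y := \sum_(s <- S) _.
(* [gram_bound] controls [Y ^+ 2], as [Y] is itself a combination of averages;
   the diagonal terms give [Y] and the others the error [2]. *)
suff : Y ^+ 2 <= Y + 2 by nra.
have YE : Y = modulus (\sum_(s <- S) (avg (F n) (kl s))^* * avg (F n) (kl s)).
  apply: complexI; rewrite modulusE /Y rmorph_sum /= ger0_norm; last first.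
    by rewrite sumr_ge0// => s _; rewrite mulrC -sqr_normc exprn_ge0.
  by apply: eq_bigr => s _; rewrite mulrC -sqr_modulus.
rewrite {1}YE; apply: (le_trans (gram_bound _ _ _ (folner_neq0 F_folner n))).
apply: (@le_trans _ _
    (\sum_(s <- S) (y s ^+ 2 + \sum_(t <- S | t != s) G s t n))); last first.
  by rewrite big_split /= lerD2l.
rewrite big_seq [leRHS]big_seq; apply: ler_sum => s sS.
rewrite (bigD1_seq s) ?fset_uniq//= !modulusJ -!/(y _); apply: lerD.
  rewrite expr2 ler_piMr ?mulr_ge0//; apply: modulus_avg_le1 => a.
  by rewrite modulusM modulusJ modulus_kloosterman mulr1.
apply: ler_sum => t ts; rewrite modulusJ -/(y _) /G.
under [in leLHS]eq_fun do rewrite kloosterman_mulJ.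
by rewrite ler_piMl ?modulus_ge0// mulr_ile1.
Qed.

(** For fixed [c] the equation [corr_freq c e = s] is quadratic in [e], and the
    product of its two roots is [c ^+ 2]. *)
Lemma corr_freq_fibre c d e : c != 0 -> d != 0 -> e != 0 ->
    corr_freq c e = corr_freq c d ->
  e \in [fset d; c ^+ 2 / d].
Proof.
move=> c0 d0 e0 /eqP; rewrite -subr_eq0.
have -> : corr_freq c e - corr_freq c d = (d - e) * (e - c ^+ 2 / d) / (c * e).
  by rewrite /corr_freq; field; rewrite c0 d0 e0.
rewrite !(mulf_eq0, invr_eq0) (negbTE c0) (negbTE e0) !orbF !subr_eq0 !inE.
by rewrite eq_sym.
Qed.

Lemma bessel_corr_freq c (A : {fset K}) : c != 0 -> 0 \notin A ->
  \forall n \near \oo,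
    \sum_(d <- A) modulus (avg (F n) (kl (corr_freq c d))) ^+ 2 <= 4.
Proof.
move=> c0 A0; have := bessel_kloosterman [fset corr_freq c d | d in A].
apply: filterS => n; set y := fun s => modulus (avg (F n) (kl s)) ^+ 2 => yn.
have y0 s : 0 <= y s by rewrite exprn_ge0// modulus_ge0.
have A_neq0 d : d \in A -> d != 0 by apply: contraTneq => ->.
rewrite (partition_big_imfset _ (corr_freq c)) /=.
apply: (@le_trans _ _
    (\sum_(s <- [fset corr_freq c d | d in A]) 2 * y s)); last first.
  by rewrite -mulr_sumr; lra.
rewrite big_seq [leRHS]big_seq; apply: ler_sum => s /imfsetP[/= d dA ->].
rewrite (eq_bigr (fun=> y (corr_freq c d))) => [|e /eqP->//].
rewrite big_const_seq iter_addr_0 -[_ *+ count _ _]mulr_natl.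
rewrite ler_wpM2r// ler_nat.
rewrite -size_filter; apply: leq_trans (_ : #|` [fset d; c ^+ 2 / d]| <= 2)%N.
  apply: uniq_leq_size; first by rewrite filter_uniq ?fset_uniq.
  move=> e; rewrite mem_filter => /andP[/eqP qe eA].
  by apply: corr_freq_fibre => //; exact: A_neq0.
by rewrite cardfs2; case: eqP.
Qed.

(** Each correlation [x] of two distinct dilates is bounded by
    [delta + x ^+ 2 / delta]: the first part is small by the choice of [delta],
    and the second, summed over one of the two dilates, is at most [4 / delta]
    by [bessel_corr_freq].  So over [N] dilates the square of the average is
    [O(delta + 1 / (N * delta))]. *)
Lemma avg_kloosterman : infinite_set [set: K] ->
  modulus (avg (F n) (kl 1)) @[n --> \oo] --> (0 : R).
Proof.
move=> K_infinite; apply/cvgrPdist_le => e e0.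
pose delta := e ^+ 2 / 4.
have delta0 : 0 < delta by rewrite divr_gt0// exprn_gt0.
(* The estimates below give
   [N ^+ 2 * y ^+ 2 <= N * (6 + 8 / delta) + 2 * N ^+ 2 * delta] for the modulus
   [y] of the average, and [N >= M] makes each term at most half of
   [N ^+ 2 * e ^+ 2]. *)
pose M := (6 + 8 / delta) / (e ^+ 2 / 2).
have M0 : 0 <= M.
  by rewrite divr_ge0// ?divr_ge0 ?sqr_ge0// addr_ge0// divr_ge0// ltW.
have [B _ NB] := infinite_set_fset (Num.bound M).+2 K_infinite.
pose C := B `\ 0.
have C0 : 0 \notin C by rewrite !inE eqxx.
have C_neq0 c : c \in C -> c != 0 by apply: contraTneq => ->.
have CB : (Num.bound M < #|` C|)%N.
  move: NB; rewrite (cardfsD1 0 B); case: (0 \in B) => /=.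
    by rewrite add1n ltnS.
  by rewrite add0n => /ltnW.
pose N : R := #|` C|%:R.
have NM : M <= N.
  by apply: le_trans (ltW (archi_boundP M0)) _; rewrite ler_nat ltnW.
have N1 : 1 <= N by rewrite ler1n (leq_ltn_trans _ CB).
pose f c a := kl 1 (c * a).
pose err1 c n := modulus (avg (F n) (f c) - avg (F n) (kl 1)).
pose err2 c d n := modulus (
  avg (F n) (fun a => kl (corr_freq c d) ((c^-1 - d^-1)^-1 * a))
  - avg (F n) (kl (corr_freq c d))).
have /cvgr0_norm_le /(_ 1 ltr01) near1 :
    \sum_(c <- C) err1 c n @[n --> \oo] --> (0 : R).
  apply: cvg_sum0 => c cC _; apply: avg_scale => //; first exact: C_neq0.
  exact: kloosterman_le1.
have /cvgr0_norm_le /(_ 1 ltr01) near2 :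
    \sum_(c <- C) \sum_(d <- C `\ c) err2 c d n @[n --> \oo] --> (0 : R).
  apply: cvg_sum0 => c cC _; apply: cvg_sum0 => d.
  rewrite in_fsetD1 => /andP[dc dC] _.
  apply: avg_scale => //; last exact: kloosterman_le1.
  by rewrite invr_eq0 subr_eq0 (inj_eq invr_inj) eq_sym.
have near3 : \forall n \near \oo, forall c, c \in C ->
    \sum_(d <- C `\ c) modulus (avg (F n) (kl (corr_freq c d))) ^+ 2 <= 4.
  apply: filter_bigI => c cC; apply: bessel_corr_freq; first exact: C_neq0.
  by rewrite !inE eqxx !andbF.
near=> n; rewrite sub0r normrN ger0_norm ?modulus_ge0//.
have E1 : \sum_(c <- C) err1 c n <= 1.
  by apply: le_trans (ler_norm _) _; near: n; exact: near1.
have E2 : \sum_(c <- C) \sum_(d <- C `\ c) err2 c d n <= 1.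
  by apply: le_trans (ler_norm _) _; near: n; exact: near2.
have E3 : forall c, c \in C ->
    \sum_(d <- C `\ c) modulus (avg (F n) (kl (corr_freq c d))) ^+ 2 <= 4.
  by near: n; exact: near3.
pose D := modulus (\sum_(c <- C) 1 * avg (F n) (f c)).
have D_ge : N * modulus (avg (F n) (kl 1)) <= D + 1.
  rewrite /N -(modulus_nat R) -modulusM.
  have -> : #|` C|%:R * avg (F n) (kl 1) = \sum_(c <- C) 1 * avg (F n) (f c)
      - \sum_(c <- C) (avg (F n) (f c) - avg (F n) (kl 1)).
    under eq_bigr do rewrite mul1r.
      rewrite sumrB opprB addrC subrK big_const_seq count_predT iter_addr_0.
    by rewrite mulr_natl.
  apply: le_trans (ler_modulusB _ _) _; rewrite lerD2l.
  by apply: le_trans E1; exact: ler_modulus_sum.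
have D_le : D ^+ 2 <= N * (1 + (N * delta + 4 / delta)) + 1.
  apply: le_trans (gram_bound _ _ _ (folner_neq0 F_folner n)) _.
  apply: (@le_trans _ _ (\sum_(c <- C)
      (1 + (N * delta + 4 / delta) + \sum_(d <- C `\ c) err2 c d n)));
    last first.
    rewrite big_split /= big_const_seq count_predT iter_addr_0.
    by rewrite -[_ *+ size _]mulr_natl lerD2l.
  rewrite big_seq [leRHS]big_seq; apply: ler_sum => c cC.
  rewrite (big_fsetD1 c cC) /= -addrA; apply: lerD.
    rewrite modulus1 !mul1r; apply: modulus_avg_le1 => a.
    by rewrite modulusM modulusJ !modulus_kloosterman mulr1.
  apply: (@le_trans _ _ (\sum_(d <- C `\ c) (delta +
      delta^-1 * modulus (avg (F n) (kl (corr_freq c d))) ^+ 2 + err2 c d n))).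
    rewrite big_seq [leRHS]big_seq; apply: ler_sum => d.
    rewrite in_fsetD1 => /andP[dc dC].
    rewrite modulus1 !mul1r.
    under eq_fun do rewrite kloosterman_dilateJ ?C_neq0// 1?eq_sym//.
    set y := avg _ (kl _); rewrite /err2; set z := avg _ _.
    have -> : modulus z = modulus (y + (z - y)) by rewrite addrC subrK.
    apply: le_trans (ler_modulusD _ _) _; rewrite lerD2r.
    set x := modulus y; have x0 : 0 <= x by exact: modulus_ge0.
    have [xd|/ltW xd] := leP x delta.
      rewrite -[leLHS]addr0 lerD// mulr_ge0 ?sqr_ge0//.
      by rewrite invr_ge0 ltW.
    rewrite -[leLHS]add0r lerD ?(ltW delta0)//.
    by rewrite mulrC ler_pdivlMr// expr2 ler_wpM2l.
  rewrite !big_split /= lerD2r; apply: lerD.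
    rewrite big_const_seq count_predT iter_addr_0 -mulr_natl.
    rewrite ler_wpM2r ?(ltW delta0)//.
    by rewrite ler_nat; apply: fsubset_leq_card; exact: fsubD1set.
  by rewrite -mulr_sumr mulrC ler_wpM2r ?invr_ge0 ?(ltW delta0)// E3.
set y := modulus _ in D_ge *.
have y0 : 0 <= y by exact: modulus_ge0.
have D0 : 0 <= D by exact: modulus_ge0.
rewrite -(@ler_pXn2r _ 2) ?nnegrE ?(ltW e0)//.
have N2 : 0 < N ^+ 2 by rewrite exprn_gt0// (lt_le_trans ltr01).
rewrite -(ler_pM2l N2).
have H1 : N ^+ 2 * y ^+ 2 <= 2 * D ^+ 2 + 2.
  rewrite -exprMn; apply: (@le_trans _ _ ((D + 1) ^+ 2)).
    by rewrite ler_pXn2r ?nnegrE ?mulr_ge0 ?addr_ge0// (le_trans ler01).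
  by rewrite -subr_ge0 (_ : _ - _ = (D - 1) ^+ 2) ?sqr_ge0//; ring.
have H2 : 6 + 8 / delta <= N * (e ^+ 2 / 2).
  by rewrite -ler_pdivrMr// divr_gt0// exprn_gt0.
have dE : 2 * delta = e ^+ 2 / 2 by rewrite /delta; field.
move: H2; rewrite (_ : 8 / delta = 2 * (4 / delta)); last first.
  by rewrite mulrA -natrM.
set k := 4 / delta in D_le * => H2.
have H3 : N * (6 + 2 * k) <= N * (N * (2 * delta)).
  by rewrite dE ler_pM2l// (lt_le_trans ltr01).
have H4 : N ^+ 2 * e ^+ 2 = N * (N * (2 * delta)) + N * (N * (2 * delta)).
  by rewrite dE; field.
rewrite H4; lra.
Unshelve. all: by end_near. Qed.

End Kloosterman.

Theorem theorem1p7 (R : realType) (K : fieldType)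
    (K_countable : countable [set: K]) (K_infinite : infinite_set [set: K])
    (F : nat -> {fset K}) (F_folner : double_folner R F)
    (xi1 xi2 : K -> R[i])
    (xi1_dual : dual R K xi1) (xi2_dual : dual R K xi2)
    (xi1_neq1 : xi1 <> cst 1) :
  (#|` F n|%:R^-1 * \sum_(a <- F n `\ 0) xi1 a * xi2 a^-1 : (R[i])^o)
    @[n --> \oo] --> (0 : (R[i])^o).
Proof.
apply/cvgrPdist_le => e e0.
have eR : e = (complex.Re e)%:C by rewrite RRe_real// gtr0_real.
have re0 : 0 < complex.Re e by rewrite -ltcR -eR.
have /cvgr0_norm_le /(_ _ (divr_gt0 re0 (ltr0n _ 2))) kl_small :=
  avg_kloosterman F_folner xi1_dual xi2_dual xi1_neq1 K_infinite.
have /cvgr0_norm_le /(_ _ (divr_gt0 re0 (ltr0n _ 2))) zero_small :=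
  avg_indicator0 F_folner K_infinite.
near=> n.
pose h a := xi1 a * xi2 a^-1.
have hE : kloosterman xi1 xi2 1 = h.
  by apply/funext => a; rewrite /kloosterman mul1r.
rewrite sub0r normrN (avg_setD1_0 h) -modulusE eR lecR.
apply: le_trans (ler_modulusB _ _) _; rewrite [leRHS]splitr; apply: lerD.
  rewrite -hE; apply: le_trans (ler_norm _) _.
  by near: n; exact: kl_small.
rewrite modulusM -hE modulus_kloosterman// mul1r.
apply: le_trans (ler_norm _) _.
by near: n; exact: zero_small.
Unshelve. all: by end_near. Qed.
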